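(* $$F_{213}(x,y)=\frac{1-x^2+x^2y-\sqrt{1+2x^2-2x^2y+x^4-2x^4y+x^4y^2-4x}}{2x(1+xy-x)}.$$
   Context: The pattern $213$ is written without dashes, so an occurrence of $213$ in $\pi=\pi_1\cdots\pi_n\in S_n$ is a position $i$ with $\pi_{i+1}<\pi_i<\pi_{i+2}$. A permutation is $1\text{-}3\text{-}2$-avoiding if there are no positions $a<b<c$ with $\pi_a<\pi_c<\pi_b$. $f_{\tau;r}(n)$ is the number of $1\text{-}3\text{-}2$-avoiding permutations in $S_n$ containing exactly $r$ occurrences of $\tau$ (with $S_0$ consisting of the empty permutation), and $F_\tau(x,y)=\sum_{n,r\ge 0} f_{\tau;r}(n)x^ny^r$, a formal power series in $x$ with coefficients in $\mathbb Z[y]$. The square root denotes the formal power series in $x$ with constant term $1$. *)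

(* Defs.v *)
From HB Require Import structures.
From mathcomp Require Import all_boot all_order all_algebra all_fingroup.
From mathcomp Require Import boolp classical_sets.

Set Implicit Arguments.
Unset Strict Implicit.
Unset Printing Implicit Defensive.

Import GRing.Theory.
Local Open Scope ring_scope.

(** * Formal power series *)

(* A wrapper is needed because [nat -> R] already has the pointwise product. *)
Record fps (R : Type) := Fps { coefs : nat -> R }.

HB.instance Definition _ (R : Type) := gen_eqMixin (fps R).
HB.instance Definition _ (R : Type) := gen_choiceMixin (fps R).

Lemma fpsP (R : Type) (A B : fps R) :
  (forall n, coefs A n = coefs B n) -> A = B.
Proof. by case: A B => [a] [b] /= ab; congr Fps; apply/funext. Qed.

Section Zmodule.
Variable R : zmodType.
Implicit Types A B C : fps R.

Definition fps0 : fps R := Fps (fun=> 0).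
Definition fps_opp A : fps R := Fps (fun n => - coefs A n).
Definition fps_add A B : fps R := Fps (fun n => coefs A n + coefs B n).

Lemma fps_addA : associative fps_add.
Proof. by move=> A B C; apply: fpsP => n /=; rewrite addrA. Qed.
Lemma fps_addC : commutative fps_add.
Proof. by move=> A B; apply: fpsP => n /=; rewrite addrC. Qed.
Lemma fps_add0 : left_id fps0 fps_add.
Proof. by move=> A; apply: fpsP => n /=; rewrite add0r. Qed.
Lemma fps_addN : left_inverse fps0 fps_opp fps_add.
Proof. by move=> A; apply: fpsP => n /=; rewrite addNr. Qed.

HB.instance Definition _ :=
  GRing.isZmodule.Build (fps R) fps_addA fps_addC fps_add0 fps_addN.

Lemma coefs0 n : coefs (0 : fps R) n = 0. Proof. by []. Qed.
Lemma coefsD A B n : coefs (A + B) n = coefs A n + coefs B n.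
Proof. by []. Qed.
Lemma coefsN A n : coefs (- A) n = - coefs A n. Proof. by []. Qed.
Lemma coefsB A B n : coefs (A - B) n = coefs A n - coefs B n.
Proof. by []. Qed.
End Zmodule.

Section Ring.
Variable R : comNzRingType.
Implicit Types (A B C : fps R) (c : R).

Definition fpsC c : fps R := Fps (fun n => if n == 0%N then c else 0).
Definition fpsX : fps R := Fps (fun n => (n == 1%N)%:R).
Definition fps_mul A B : fps R :=
  Fps (fun n => \sum_(i < n.+1) coefs A i * coefs B (n - i)%N).

Definition fps_trunc N A : {poly R} := \poly_(i < N.+1) coefs A i.

Lemma coef_fps_trunc N A n : (n <= N)%N -> (fps_trunc N A)`_n = coefs A n.
Proof. by move=> nN; rewrite coef_poly ltnS nN. Qed.

Lemma coefs_mul_trunc N A B n : (n <= N)%N ->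
  coefs (fps_mul A B) n = (fps_trunc N A * fps_trunc N B)`_n.
Proof.
move=> nN; rewrite coefM /=; apply: eq_bigr => i _.
rewrite !coef_fps_trunc //; first exact: leq_trans (leq_subr _ _) nN.
by apply: leq_trans nN; rewrite -ltnS ltn_ord.
Qed.

Lemma fps_mulC : commutative fps_mul.
Proof.
by move=> A B; apply: fpsP => n; rewrite !(coefs_mul_trunc _ _ (leqnn n)) mulrC.
Qed.

Lemma fps_mulA : associative fps_mul.
Proof.
move=> A B C; apply: fpsP => n.
have -> : coefs (fps_mul A (fps_mul B C)) n =
    (fps_trunc n A * (fps_trunc n B * fps_trunc n C))`_n.
  rewrite coefM; apply: eq_bigr => i _.
  have iN : (i <= n)%N by rewrite -ltnS.
  by rewrite coef_fps_trunc // (coefs_mul_trunc _ _ (leq_subr i n)).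
rewrite mulrA coefM; apply: eq_bigr => i _.
have iN : (i <= n)%N by rewrite -ltnS.
by rewrite (coefs_mul_trunc _ _ iN) coef_fps_trunc ?leq_subr.
Qed.

Lemma coefs_mulC c A n : coefs (fps_mul (fpsC c) A) n = c * coefs A n.
Proof.
rewrite /= big_ord_recl subn0 big1 ?addr0 // => i _.
by rewrite mul0r.
Qed.

Lemma fps_mul1 : left_id (fpsC 1) fps_mul.
Proof. by move=> A; apply: fpsP => n; rewrite coefs_mulC mul1r. Qed.

Lemma fps_mulD : left_distributive fps_mul +%R.
Proof.
move=> A B C; apply: fpsP => n /=; rewrite -big_split; apply: eq_bigr => i _.
by rewrite /= mulrDl.
Qed.

Lemma fps1_neq0 : fpsC 1 != 0.
Proof.
by apply/eqP => /(congr1 (fun A => coefs A 0%N))/eqP; rewrite /= oner_eq0.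
Qed.

HB.instance Definition _ := GRing.Zmodule_isComNzRing.Build (fps R)
  fps_mulA fps_mulC fps_mul1 fps_mulD fps1_neq0.

Lemma coefs1 n : coefs (1 : fps R) n = (n == 0%N)%:R.
Proof. by case: n. Qed.

Lemma coefsM A B n :
  coefs (A * B) n = \sum_(i < n.+1) coefs A i * coefs B (n - i)%N.
Proof. by []. Qed.

Lemma coefsCM c A n : coefs (fpsC c * A) n = c * coefs A n.
Proof. exact: coefs_mulC. Qed.

Lemma coefsXM A n : coefs (fpsX * A) n = if n is m.+1 then coefs A m else 0.
Proof.
rewrite coefsM big_ord_recl mul0r add0r; case: n => [|n]; first by rewrite big_ord0.
rewrite big_ord_recl mul1r subSS subn0 big1 ?addr0 // => i _.
by rewrite mul0r.
Qed.

End Ring.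

Section Unit.
Variable R : comUnitRingType.

Definition fps_unit : {pred fps R} := fun A => `[< exists B, B * A = 1 >].
Definition fps_inv (A : fps R) : fps R := xget A [set B | B * A = 1].

Lemma fps_mulVx : {in fps_unit, left_inverse 1 fps_inv *%R}.
Proof. by move=> A /asboolP exB; rewrite /fps_inv; apply: xgetPex exB. Qed.

Lemma fps_unitPl (A B : fps R) : B * A = 1 -> fps_unit A.
Proof. by move=> BA; apply/asboolP; exists B. Qed.

Lemma fps_invr_out : {in [predC fps_unit], fps_inv =1 id}.
Proof.
move=> A /asboolP nB; rewrite /fps_inv; case: xgetP => // B _ BA.
by case: nB; exists B.
Qed.

HB.instance Definition _ := GRing.ComNzRing_hasMulInverse.Build (fps R)
  fps_mulVx fps_unitPl fps_invr_out.
End Unit.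

Section Domain.
Variable R : idomainType.

Lemma fps_valuation (A : fps R) : A != 0 ->
  exists2 m, coefs A m != 0 & forall i, (i < m)%N -> coefs A i = 0.
Proof.
move=> A0; have exm : exists m, coefs A m != 0.
  apply: contrapT => nex; case/eqP: A0; apply: fpsP => n; apply/eqP.
  by apply: contrapT => /negP An; apply: nex; exists n.
case: (ex_minnP exm) => m Am minm; exists m => // i im; apply/eqP.
by apply: contraTT im => /minm; rewrite -leqNgt.
Qed.

Lemma fps_mulf_eq0 (A B : fps R) : A * B = 0 -> (A == 0) || (B == 0).
Proof.
move=> AB; apply/norP => -[/fps_valuation[m Am minm] /fps_valuation[n Bn minn]].
have /eqP := congr1 (fun C => coefs C (m + n)%N) AB.
have lt_m : (m < (m + n).+1)%N by rewrite ltnS leq_addr.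
rewrite coefsM coefs0 (bigD1 (Ordinal lt_m)) //= addKn big1 ?addr0.
  by rewrite mulf_eq0 (negPf Am) (negPf Bn).
move=> i; rewrite -val_eqE /= neq_ltn => /orP[/minm->|mi]; first by rewrite mul0r.
rewrite minn ?mulr0 // ltn_subLR; first by rewrite ltn_add2r.
by rewrite -ltnS ltn_ord.
Qed.

HB.instance Definition _ :=
  GRing.ComUnitRing_isIntegral.Build (fps R) fps_mulf_eq0.

(* [fps_sqrt A] is the square root of [A] with constant term 1, and the junk
   value 0 when there is none; it is unique as soon as 2 != 0 in R. *)
Definition fps_sqrt (A : fps R) : fps R :=
  xget 0 [set S | coefs S 0 = 1 /\ S ^+ 2 = A].

Lemma fps_sqrt_unique (A S : fps R) :
  2 != 0 :> R -> coefs S 0 = 1 -> S ^+ 2 = A -> fps_sqrt A = S.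
Proof.
move=> two0 S0 SA; apply: xget_unique => [//|T [T0 TA]].
have : (T - S) * (T + S) = 0 by rewrite -subr_sqr TA SA subrr.
move/eqP; rewrite mulf_eq0 subr_eq0 => /orP[/eqP//|/eqP TS].
have /eqP := congr1 (fun C => coefs C 0%N) TS.
by rewrite coefsD T0 S0 coefs0 (negPf two0).
Qed.
End Domain.

(** * Pattern occurrences; positions and values are numbered from 0 *)

Definition avoids_1_3_2 (n : nat) (s : 'S_n) : bool :=
  [forall a : 'I_n, forall b : 'I_n, forall c : 'I_n,
    ~~ [&& (a < b)%N, (b < c)%N, (s a < s c)%N & (s c < s b)%N]].

Definition occ_213 (n : nat) (s : 'S_n) : nat :=
  #|[set i : 'I_n | [exists j : 'I_n, exists k : 'I_n,
      [&& j == i.+1 :> nat, k == i.+2 :> nat, (s j < s i)%N & (s i < s k)%N]]]|.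

Definition f_213 (r n : nat) : nat :=
  #|[set s : 'S_n | avoids_1_3_2 s & occ_213 s == r]|.

Lemma f_213_eq0 (r n : nat) : (n < r)%N -> f_213 r n = 0%N.
Proof.
move=> nr; apply/eqP; rewrite cards_eq0; apply/eqP/setP => s.
rewrite !inE; apply/negbTE; rewrite negb_and orbC neq_ltn.
by rewrite (leq_ltn_trans (max_card _)) // card_ord.
Qed.

(* By [f_213_eq0], the sum over all r of f_213 r n * y^r stops at r = n. *)
Definition F_213 : fps {poly int} :=
  Fps (fun n => \poly_(r < n.+1) (f_213 r n)%:R).

(* Main.v *)
(* Write a 1-3-2-avoiding permutation as L m R with m its maximum. Every letter
   of L exceeds every letter of R, and L, R are arbitrary 1-3-2-avoiding words.
   The occurrences of 213 are those of L, those of R, and one more, ending at m,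
   when L ends with a descent. Let F count all the words, D those ending with a
   descent, and let G = F + (y - 1) D count the words L with the extra occurrence
   included. Then F = 1 + x G F, and D = x G (D + x) since m R ends with a descent
   exactly when R has one letter or ends with a descent. Hence D = x (F - 1), and
   F is a root of a quadratic whose discriminant is the radicand. *)
Require Import Defs.
From mathcomp Require Import all_boot all_order all_algebra.
From mathcomp Require Import all_fingroup zify ring.

Set Implicit Arguments.
Unset Strict Implicit.
Unset Printing Implicit Defensive.

Import GRing.Theory.
Local Open Scope ring_scope.

(** * Pattern statistics on words, and how they behave around a maximal letter *)

Section Words.
Local Open Scope nat_scope.
Implicit Types (w L R : seq nat) (m n k : nat).

Fixpoint av132 w : bool :=
  if w is a :: w' then
    pairwise (fun b c => ~~ ((a < c) && (c < b))) w' && av132 w'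
  else true.

Fixpoint occ213 w : nat :=
  if w is a :: w' then
    (if w' is [:: b, c & _] then (b < a) && (a < c) else false) + occ213 w'
  else 0.

Fixpoint ends_desc w : bool :=
  if w is a :: w' then (if w' is [:: b] then b < a else ends_desc w')
  else false.

Lemma av132P w :
  reflect (forall i j k, i < j -> j < k -> k < size w ->
             ~~ ((nth 0 w i < nth 0 w k) && (nth 0 w k < nth 0 w j)))
          (av132 w).
Proof.
elim: w => [|a w IHw] /=; first by apply: ReflectT => i j [].
apply: (iffP andP) => [[/(pairwiseP 0) pw /IHw aw]|aw].
  case=> [|i] [|j] [|k] //; rewrite !ltnS /= => ij jk kw; last exact: aw.
  by apply: pw => //; exact: ltn_trans kw.
split; last by apply/IHw => i j k ij jk kw; apply: (aw i.+1 j.+1 k.+1).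
apply/(pairwiseP 0) => j k _ kw jk; exact: (aw 0 j.+1 k.+1).
Qed.

Lemma av132_map_add c w : av132 (map (addn c) w) = av132 w.
Proof.
elim: w => //= a w ->; rewrite pairwise_map; congr andb.
by apply: eq_pairwise => b d /=; rewrite !ltn_add2l.
Qed.

Lemma occ213_map_add c w : occ213 (map (addn c) w) = occ213 w.
Proof. by elim: w => //= a [|b [|d w]] //= ->; rewrite !ltn_add2l. Qed.

Lemma ends_desc_map_add c w : ends_desc (map (addn c) w) = ends_desc w.
Proof. by elim: w => //= a [|b [|d w]] //= _; rewrite ltn_add2l. Qed.

Lemma pairwise_no32_above w m : all (ltn^~ m) w ->
  pairwise (fun b c => ~~ ((m < c) && (c < b))) w.
Proof.
move=> wm; apply/(pairwiseP 0) => j k _ kw _.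
by have /= := allP wm _ (mem_nth 0 kw); lia.
Qed.

(* A letter of [L] and a larger letter of [R] would form 1-3-2 with [m]. *)
Lemma av132_cat_max L R m :
    uniq (L ++ m :: R) -> all (ltn^~ m) L -> all (ltn^~ m) R ->
  av132 (L ++ m :: R) = [&& allrel gtn L R, av132 L & av132 R].
Proof.
move=> + + Rm; elim: L => [_ _|a L IHL] /=.
  by rewrite pairwise_no32_above.
rewrite mem_cat inE !negb_or => /andP[/and3P[aL am aR] uLR] /andP[ltam Lm].
rewrite IHL // allrel_consl pairwise_cat allrel_consr /=.
have -> : all (fun c => ~~ ((a < c) && (c < m))) R = all (gtn a) R.
  apply: eq_in_all => c cR; have /= := allP Rm c cR.
  by case: (ltngtP c a) cR aR => [||->]; lia || move=> ->.
have [Ra|_] /= := boolP (all (gtn a) R); last by rewrite !andbF.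
have -> : all (fun b => ~~ ((a < m) && (m < b))) L.
  by apply/allP => b /(allP Lm) /=; lia.
have -> : allrel (fun b c => ~~ ((a < c) && (c < b))) L R.
  by apply/allrelP => b c _ /(allP Ra) /=; lia.
rewrite (pairwise_no32_above Ra).
by rewrite andbT /= -!andbA; do !bool_congr.
Qed.

(** A window of three letters that contains [m] can only use it as the 3, hence as its last letter.
    The other two letters are then the last two of [L], and the window is an occurrence exactly when
    they form a descent. *)
Lemma occ213_cat_max L R m : all (ltn^~ m) L -> all (ltn^~ m) R ->
  occ213 (L ++ m :: R) = occ213 L + ends_desc L + occ213 R.
Proof.
move=> + Rm; elim: L => [_|a L IHL] /=.
  case: R Rm => [|b [|c R]] //= /and3P[_ cm _].
  by rewrite [m < c]ltnNge (ltnW cm) /= andbF.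
move=> /andP[am Lm]; rewrite IHL //.
case: L Lm {IHL} => [|b [|c L]] /=; last by lia.
  by case: R Rm => [|c R] _; lia.
by case/andP; lia.
Qed.

Lemma ends_desc_cat_max L R m : all (ltn^~ m) L -> all (ltn^~ m) R ->
  ends_desc (L ++ m :: R) = (size R == 1) || ends_desc R.
Proof.
move=> + Rm; elim: L => [_|a L IHL] /=.
  by case: R Rm => [|b [|c R]] //= /andP[->].
move=> /andP[am Lm]; rewrite IHL //.
case: L Lm {IHL} => [|b [|c L]] //= _; case: R Rm => //= _.
by rewrite ltnNge (ltnW am).
Qed.

(** * Splitting a 1-3-2-avoiding word at its maximum *)

Definition words132 n : seq (seq nat) :=
  [seq w <- permutations (iota 0 n) | av132 w].

Lemma mem_words132 n w :
  (w \in words132 n) = av132 w && perm_eq w (iota 0 n).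
Proof. by rewrite mem_filter mem_permutations. Qed.

Lemma words132_uniq n : uniq (words132 n).
Proof. by rewrite filter_uniq ?permutations_uniq. Qed.

Lemma perm_iota_size n w : perm_eq w (iota 0 n) -> size w = n.
Proof. by move/perm_size; rewrite size_iota. Qed.

Lemma perm_iota_lt n w : perm_eq w (iota 0 n) -> all (ltn^~ n) w.
Proof. by move/perm_mem=> wE; apply/allP => a; rewrite wE mem_iota. Qed.

(** Sorting [R] and [L] separately and concatenating gives a sorted rearrangement of [iota 0 n],
    hence [iota 0 n] itself, which is then cut after [size R] letters. *)
Lemma allrel_gtn_perm_iota L R n : allrel gtn L R ->
    perm_eq (L ++ R) (iota 0 n) ->
  perm_eq L (iota (size R) (size L)) /\ perm_eq R (iota 0 (size R)).
Proof.
move=> LR pLR.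
have : sort leq R ++ sort leq L = iota 0 n.
  apply: (sorted_eq leq_trans anti_leq).
  - rewrite sorted_pairwise; last exact: leq_trans.
    rewrite pairwise_cat -!(sorted_pairwise leq_trans) !sort_sorted ?andbT //;
      try exact: leq_total.
    apply/allrelP => r l; rewrite !mem_sort => rR lL.
    exact/ltnW/(allrelP LR).
  - exact: iota_sorted.
  - apply: perm_trans pLR; rewrite perm_catC.
    by apply: perm_cat; rewrite perm_sort.
have nE : n = size R + size L.
  by rewrite -(perm_iota_size pLR) size_cat addnC.
rewrite nE iotaD add0n => /eqP; rewrite eqseq_cat ?size_sort ?size_iota //.
by case/andP=> /eqP <- /eqP <-; rewrite ![perm_eq _ (sort _ _)]perm_sym !perm_sort.
Qed.

Lemma perm_cat_cons_iota L R n :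
  perm_eq (L ++ n :: R) (iota 0 n.+1) = perm_eq (L ++ R) (iota 0 n).
Proof.
rewrite -addn1 iotaD add0n -[n :: R]cat1s perm_catCA perm_sym perm_catC.
by rewrite perm_cat2l perm_sym.
Qed.

(** Both factors are kept on the letters from 0. For a left factor of size [k] and a right one of
    size [n - k], the shift puts the left letters just above the right ones and below the maximum
    [n]. *)
Definition join132 n k LR : seq nat := map (addn (n - k)) LR.1 ++ n :: LR.2.

(** All left factors have size [k], so a joined word determines where to cut it, and the shift is
    injective. *)
Lemma join132_uniq n k : k <= n ->
  uniq [seq join132 n k (L, R) | L <- words132 k, R <- words132 (n - k)].
Proof.
move=> kn; apply: allpairs_uniq; rewrite ?words132_uniq //.
move=> ? ? /allpairsP[[L R] /= [+ _ ->]] /allpairsP[[L' R'] /= [+ _ ->]] /=.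
rewrite !mem_words132 => /andP[_ /perm_iota_size sL].
move=> /andP[_ /perm_iota_size sL'] /eqP.
rewrite /join132 /= eqseq_cat ?size_map ?sL ?sL' // eqseq_cons eqxx /=.
by case/andP=> /eqP/(inj_map (@addnI _)) -> /eqP ->.
Qed.

Lemma words132_split n k : k <= n ->
  perm_eq [seq w <- words132 n.+1 | index n w == k]
          [seq join132 n k (L, R) | L <- words132 k, R <- words132 (n - k)].
Proof.
move=> kn; apply: uniq_perm => [||w].
- exact/filter_uniq/words132_uniq.
- exact: join132_uniq.
 rewrite mem_filter mem_words132; apply/and3P/allpairsP.
  case=> /eqP ik aw pw.
  have nw : n \in w by rewrite (perm_mem pw) mem_iota add0n ltnSn.
  have uw : uniq w by rewrite (perm_uniq pw) iota_uniq.
  case: {nw}(path.splitPr nw) ik aw pw uw => L R ik aw pw uw.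
  have nL : n \notin L.
    by move: uw; rewrite cat_uniq /= negb_or => /and3P[_ /andP[]].
  have sL : size L = k by rewrite -ik index_cat (negPf nL) /= eqxx addn0.
  have pLR : perm_eq (L ++ R) (iota 0 n).
    by rewrite -perm_cat_cons_iota.
  have [Ln Rn] : all (ltn^~ n) L /\ all (ltn^~ n) R.
    by apply/andP; rewrite -all_cat; apply: perm_iota_lt.
  move: aw; rewrite av132_cat_max // => /and3P[LR aL aR].
  have [pL pR] := allrel_gtn_perm_iota LR pLR.
  have sR : size R = n - k by rewrite -(perm_iota_size pLR) size_cat sL addKn.
  move: pL pR; rewrite sL sR -{1}[n - k]addn0 iotaDl => pL pR.
  (* The letters of [L] are at least [n - k], so truncated subtraction undoes the shift. *)
  have LE : L = map (addn (n - k)) (map (subn^~ (n - k)) L).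
    rewrite -map_comp map_id_in // => a.
    by rewrite (perm_mem pL) => /mapP[b _ ->] /=; rewrite addKn.
  exists (map (subn^~ (n - k)) L, R); split=> /=.
  - rewrite mem_words132 -(av132_map_add (n - k)) -LE aL /=.
    by apply: (@perm_map_inj _ _ (addn (n - k))); [exact: addnI|rewrite -LE].
  - by rewrite mem_words132 aR.
  - by rewrite /join132 /= -LE.
(* Conversely, a join has its maximum at position [k], and the shift makes every left letter exceed
   every right one, as avoidance demands. *)
case=> -[L R] [LW RW ->]; rewrite /= !mem_words132 in LW RW.
case/andP: LW RW => aL pL /andP[aR pR].
rewrite /join132 [(L, R).1]/= [(L, R).2]/=; set L' := map _ L.
have pL' : perm_eq L' (iota (n - k) k).
  by rewrite -[n - k]addn0 iotaDl perm_map // addn0.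
have pLR : perm_eq (L' ++ n :: R) (iota 0 n.+1).
  rewrite perm_cat_cons_iota -(subnK kn) iotaD perm_catC.
  exact: perm_cat.
have [Ln Rn] : all (ltn^~ n) L' /\ all (ltn^~ n) R.
  split; apply/allP => a; rewrite ?(perm_mem pL') ?(perm_mem pR) mem_iota /=; lia.
split=> //.
  rewrite index_cat; case: ifP => [/(allP Ln)|_]; first by rewrite /= ltnn.
  by rewrite /= eqxx addn0 size_map (perm_iota_size pL).
rewrite av132_cat_max ?(perm_uniq pLR) ?iota_uniq // av132_map_add aL aR !andbT.
apply/allrelP => a b; rewrite (perm_mem pL') (perm_mem pR) !mem_iota /=; lia.
Qed.


(** The words are sorted by the position [k] of their maximum, and each class is reindexed by
    [words132_split]. *)
Lemma words132_sum_recl (V : nmodType) (h : seq nat -> V) n :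
  (\sum_(w <- words132 n.+1) h w =
   \sum_(k < n.+1) \sum_(L <- words132 k) \sum_(R <- words132 (n - k))
     h (join132 n k (L, R)))%R.
Proof.
transitivity (\sum_(w <- words132 n.+1)
                \sum_(k < n.+1 | index n w == k) h w)%R.
  apply: eq_big_seq => w; rewrite mem_words132 => /andP[_ pw].
  have iw : index n w < n.+1.
    by rewrite -(perm_iota_size pw) index_mem (perm_mem pw) mem_iota /=.
  by rewrite (big_pred1 (Ordinal iw)) // => k; rewrite eq_sym.
under eq_bigr do rewrite big_mkcond.
rewrite exchange_big; apply: eq_bigr => k _; rewrite -big_mkcond -big_filter.
have kn : k <= n by rewrite -ltnS.
by rewrite (perm_big _ (words132_split kn)) big_allpairs_dep.
Qed.

(** * From permutations to words *)

Definition word n (s : 'S_n) : seq nat := [seq val (s i) | i <- enum 'I_n].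

Lemma size_word n (s : 'S_n) : size (word s) = n.
Proof. by rewrite size_map size_enum_ord. Qed.

Lemma nth_word n (s : 'S_n) (i : 'I_n) : nth 0 (word s) i = s i.
Proof. by rewrite (nth_map i) ?size_enum_ord // nth_ord_enum. Qed.

Lemma word_inj n : injective (@word n).
Proof.
move=> s t st; apply/permP => i; apply: val_inj.
by rewrite /= -!nth_word st.
Qed.

(** Since [word] is injective and both lists have n! entries, one inclusion is enough. *)
Lemma perm_word n :
  perm_eq [seq word s | s <- enum 'S_n] (permutations (iota 0 n)).
Proof.
have uw : uniq [seq word s | s <- enum 'S_n].
  by rewrite (map_inj_uniq (@word_inj n)) enum_uniq.
apply: uniq_perm; rewrite ?permutations_uniq //.
apply: (fun sub le => (uniq_min_size uw sub le).2) => [w /mapP[s _ ->]|].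
  rewrite mem_permutations /word -val_enum_ord (map_comp val).
  apply: perm_map; apply: uniq_perm.
  - by rewrite (map_inj_uniq (@perm_inj _ s)) enum_uniq.
  - exact: enum_uniq.
  - move=> i; rewrite mem_enum; apply/mapP; exists (s^-1 i)%g.
      by rewrite mem_enum.
    by rewrite permKV.
rewrite size_permutations ?iota_uniq // size_iota size_map -cardE.
by rewrite card_Sn.
Qed.

Lemma av132_word n (s : 'S_n) : av132 (word s) = avoids_1_3_2 s.
Proof.
apply/av132P/forallP => [H a|H i j k ij jk].
  apply/forallP => b; apply/forallP => c; apply/and4P => -[ab bc ac cb].
  have := H a b c ab bc; rewrite !nth_word size_word ltn_ord ac cb.
  by move/(_ isT).
rewrite size_word => kn; have jn := ltn_trans jk kn; have i_n := ltn_trans ij jn.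
have /forallP/(_ (Ordinal jn))/forallP/(_ (Ordinal kn)) := H (Ordinal i_n).
by rewrite -!nth_word /= ij jk.
Qed.

(** Turns the recursive count into a count by starting position, the form of [occ_213]. *)
Lemma occ213_sum w :
  occ213 w = \sum_(i < size w)
    [&& i.+2 < size w, nth 0 w i.+1 < nth 0 w i & nth 0 w i < nth 0 w i.+2].
Proof.
elim: w => [|a w IHw] /=; first by rewrite big_ord0.
rewrite big_ord_recl IHw; congr addn.
by case: w {IHw} => [|b [|c w]].
Qed.

Lemma occ213_word n (s : 'S_n) : occ213 (word s) = occ_213 s.
Proof.
rewrite occ213_sum size_word /occ_213 -sum1dep_card [RHS]big_mkcond /=.
apply: eq_bigr => i _; rewrite nth_word.
case: ifP => [/existsP[j /existsP[k /and4P[/eqP ji /eqP ki sji sik]]]|].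
  by rewrite -ki -ji !nth_word sji sik ltn_ord.
apply: contraFeq; rewrite eqb0 negbK => /and3P[kn sji sik].
apply/existsP; exists (Ordinal (ltnW kn)).
apply/existsP; exists (Ordinal kn).
by rewrite /= !eqxx -!nth_word /= nth_word sji.
Qed.

Lemma words132_sum_perm (V : nmodType) (h : seq nat -> V) n :
  (\sum_(w <- words132 n) h w = \sum_(s : 'S_n | avoids_1_3_2 s) h (word s))%R.
Proof.
rewrite big_filter -(perm_big _ (perm_word n)) big_map big_enum_cond.
by apply: eq_bigl => s; rewrite av132_word inE.
Qed.

End Words.

(** * Generating functions and their equations *)

Definition words132_gf (h : seq nat -> {poly int}) : fps {poly int} :=
  Fps (fun n => \sum_(w <- words132 n) h w).

(** The sum over [k] in the splitting at the maximum is a Cauchy product, and the maximum itself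
    gives the factor x. The left weight [g] must ignore shifts because joining shifts the left
    factor. *)
Lemma words132_gf_join (h g f : seq nat -> {poly int}) :
    (forall c L, g (map (addn c) L) = g L) ->
    (forall L R m, all (ltn^~ m) L -> all (ltn^~ m) R ->
       h (L ++ m :: R) = g L * f R) ->
  words132_gf h =
    fpsC (h [::]) + fpsX _ * (words132_gf g * words132_gf f).
Proof.
move=> g_add h_join; apply: fpsP => -[|n]; rewrite coefsD coefsXM /=.
  by rewrite big_seq1 addr0.
rewrite add0r words132_sum_recl; apply: eq_bigr => k _.
rewrite big_distrl; apply: eq_big_seq => L LW.
rewrite big_distrr; apply: eq_big_seq => R RW /=.
move: LW RW; rewrite !mem_words132 => /andP[_ pL] /andP[_ pR].
have kn : (k <= n)%N by rewrite -ltnS.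
rewrite /join132 h_join ?g_add //; apply/allP => a /=.
  by case/mapP=> b; rewrite (perm_mem pL) mem_iota /= => bk ->; lia.
by rewrite (perm_mem pR) mem_iota /=; lia.
Qed.

(** [gf_occ], [gf_desc] and [gf_occ_max] are the series F, D and G; the polynomial variable ['X] is
    y. *)
Definition gf_occ := words132_gf (fun w => 'X^(occ213 w)).
Definition gf_desc := words132_gf (fun w => (ends_desc w)%:R * 'X^(occ213 w)).
(* The exponent is the number of occurrences in [w] followed by a larger letter. *)
Definition gf_occ_max := words132_gf (fun w => 'X^(occ213 w + ends_desc w)).

Lemma F_213E : F_213 = gf_occ.
Proof.
apply: fpsP => n /=; apply/polyP => r; rewrite coef_poly coef_sum.
have -> : (if (r < n.+1)%N then (f_213 r n)%:R else 0) = (f_213 r n)%:R :> int.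
  by case: ltnP => // /f_213_eq0 ->.
rewrite words132_sum_perm /f_213 -sum1dep_card natr_sum big_mkcondr /=.
by apply: eq_bigr => s _; rewrite coefXn occ213_word eq_sym; case: eqP.
Qed.

Lemma gf_occ_rec : gf_occ = 1 + fpsX _ * (gf_occ_max * gf_occ).
Proof.
apply: words132_gf_join => [c L|L R m Lm Rm].
  by rewrite occ213_map_add ends_desc_map_add.
by rewrite occ213_cat_max // exprD.
Qed.

Lemma gf_desc_rec : gf_desc = fpsX _ * (gf_occ_max * (gf_desc + fpsX _)).
Proof.
(* This weight also admits the one-letter word, which accounts for the summand x added to D. *)
pose f w : {poly int} :=
  ((size w == 1%N) || ends_desc w)%:R * 'X^(occ213 w).
have -> : gf_desc + fpsX _ = words132_gf f.
  apply: fpsP => n; rewrite coefsD /=.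
  have [->|n1] := eqVneq n 1%N.
    by rewrite !big_seq1 /f /= mul0r add0r mulr1.
  rewrite addr0; apply: eq_big_seq => w; rewrite mem_words132 /f.
  by case/andP=> _ /perm_iota_size ->; rewrite (negPf n1).
pose g w : {poly int} := 'X^(occ213 w + ends_desc w).
rewrite /gf_desc (words132_gf_join (g := g) (f := f)) /g.
- rewrite mul0r (_ : fpsC 0 = 0) ?add0r //.
  by apply: fpsP => n /=; case: eqP.
- by move=> c L; rewrite occ213_map_add ends_desc_map_add.
move=> L R m Lm Rm; rewrite ends_desc_cat_max // occ213_cat_max // /f.
by rewrite [in LHS]exprD mulrCA.
Qed.

(** For e equal to 0 or 1, y^e = 1 + (y - 1) e. *)
Lemma gf_occ_maxE : gf_occ_max = gf_occ + (fpsC 'X - 1) * gf_desc.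
Proof.
apply: fpsP => n; rewrite mulrBl mul1r coefsD coefsB coefsCM /=.
rewrite big_distrr -sumrB -big_split /=; apply: eq_bigr => w _.
by rewrite exprD; case: ends_desc; rewrite ?expr0 ?expr1 /=; ring.
Qed.

(** * Elimination of D and G, and the closed form *)

Lemma gf_descE : gf_desc = fpsX _ * (gf_occ - 1).
Proof.
have := gf_occ_rec; have := gf_desc_rec.
move: gf_occ gf_desc gf_occ_max (fpsX _) => A D G x eD eA.
have eA' : x * G * A = A - 1 by rewrite {2}eA; ring.
have : D * A = D * (x * G * A) + x * (x * G * A) by rewrite {1}eD; ring.
rewrite eA' => /eqP; rewrite -subr_eq0 => /eqP e.
by apply/eqP; rewrite -subr_eq0 -e; apply/eqP; ring.
Qed.

Lemma gf_occ_quadratic (x := fpsX {poly int}) (y := fpsC ('X : {poly int})) :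
  x * (1 + x * y - x) * gf_occ ^+ 2 - (1 - x ^+ 2 + x ^+ 2 * y) * gf_occ + 1 = 0.
Proof.
have := gf_occ_rec; rewrite gf_occ_maxE gf_descE -/x -/y => e.
transitivity
  (1 + x * ((gf_occ + (y - 1) * (x * (gf_occ - 1))) * gf_occ) - gf_occ).
  by ring.
by rewrite -e subrr.
Qed.

(** The denominator has constant term 0 and is not invertible as a power series, so the quotient is
    taken in the fraction field. *)
Theorem theorem3p3 :
  let x : fps {poly int} := fpsX {poly int} in
  let y : fps {poly int} := fpsC ('X : {poly int}) in
  tofrac F_213 =
    tofrac (1 - x ^+ 2 + x ^+ 2 * y
            - fps_sqrt (1 + 2 * x ^+ 2 - 2 * x ^+ 2 * y + x ^+ 4
                        - 2 * x ^+ 4 * y + x ^+ 4 * y ^+ 2 - 4 * x))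
    / tofrac (2 * x * (1 + x * y - x))
  :> {fraction (fps {poly int})}.
Proof.
move=> x y; rewrite F_213E.
have two0 : 2 != 0 :> {poly int} by rewrite -polyC_natr polyC_eq0.
have coef0_xM (A : fps {poly int}) : coefs (x * A) 0 = 0 by rewrite coefsXM.
(* Write the quadratic as a F^2 - b F + 1 = 0, with a = x (1 + x y - x) and b = 1 - x^2 + x^2 y. The
   root of the discriminant b^2 - 4 a with constant term 1 is b - 2 a F. *)
rewrite (fps_sqrt_unique
  (S := 1 - x ^+ 2 + x ^+ 2 * y - 2 * x * (1 + x * y - x) * gf_occ)).
(* Each factor has a nonzero coefficient: that of x^0 in 2 and in 1 + x y - x, that of x^1 in x. *)
- have den0 : 2 * x * (1 + x * y - x) != 0.
    rewrite !mulf_neq0 //; apply/eqP.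
    + by move/(congr1 (fun A => coefs A 0%N))/eqP; rewrite (negPf two0).
    + by move/(congr1 (fun A => coefs A 1%N))/eqP; rewrite /= oner_eq0.
    + move/(congr1 (fun A => coefs A 0%N))/eqP.
      by rewrite coefsB coefsD coef0_xM /= addr0 subr0 oner_eq0.
  rewrite opprB addrC subrK rmorphM /= mulrC mulKf // tofrac_eq0.
  exact: den0.
- exact: two0.
- rewrite (_ : _ - _ = 1 + x * (- x + x * y - 2 * (1 + x * y - x) * gf_occ)).
    by rewrite coefsD coef0_xM addr0.
  by ring.
(* The difference (b - 2 a F)^2 - (b^2 - 4 a) is 4 a times the quadratic at F. *)
apply/eqP; rewrite -subr_eq0; apply/eqP.
rewrite -[RHS](mulr0 (4 * x * (1 + x * y - x))) -gf_occ_quadratic -/x -/y.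
by ring.
Qed.
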